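(* Let $\alpha,\beta>0$, let $N\ge 1$, and let $-1=x_0<x_1<\dots<x_N=1$. Let $H_N\in\mathbb{R}^{N\times N}$ be the weighted Jacobi histopolation matrix associated with the basis $P^{(\alpha+1,\beta+1)}_{j-1}$, $j=1,\dots,N$, let $\Delta_N\in\mathbb{R}^{N\times(N+1)}$ be the backward difference matrix and $\Psi_N\in\mathbb{R}^{(N+1)\times N}$ the primitive sampling matrix (all defined in the context). Then $$H_N=\Delta_N\Psi_N .$$
   Context: For $\alpha,\beta>-1$, $\omega_{\alpha,\beta}(t)=(1-t)^\alpha(1+t)^\beta$ on $[-1,1]$, and $P_j^{(\alpha,\beta)}$ is the Jacobi polynomial of degree $j$, orthogonal on $[-1,1]$ with respect to $\omega_{\alpha,\beta}$, with the standard normalization $P_j^{(\alpha,\beta)}(1)=\frac{\Gamma(j+\alpha+1)}{\Gamma(j+1)\Gamma(\alpha+1)}$. Put $s_i=[x_{i-1},x_i]$ and $h_i=x_i-x_{i-1}$ for $i=1,\dots,N$. Histopolation matrix: $[H_N]_{i,j}=\frac1{h_i}\int_{s_i}P^{(\alpha+1,\beta+1)}_{j-1}(t)\,\omega_{\alpha,\beta}(t)\,dt$, $i,j=1,\dots,N$. Backward difference: $[\Delta_N\boldsymbol u]_i=\frac{u_i-u_{i-1}}{h_i}$, $i=1,\dots,N$, for $\boldsymbol u=[u_0,\dots,u_N]^\top\in\mathbb{R}^{N+1}$. Weighted primitives: $\psi_j(x)=\int_{-1}^xP^{(\alpha+1,\beta+1)}_{j-1}(t)\,\omega_{\alpha,\beta}(t)\,dt$,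 $j=1,\dots,N$; primitive sampling matrix: $[\Psi_N]_{k,j}=\psi_j(x_k)$, $k=0,\dots,N$, $j=1,\dots,N$. *)

(* Defs.v *)
From HB Require Import structures.
From mathcomp Require Import all_boot all_order all_algebra.
From mathcomp Require Import all_classical all_reals all_analysis.

Set Implicit Arguments.
Unset Strict Implicit.
Unset Printing Implicit Defensive.

Import Order.TTheory GRing.Theory Num.Theory.
Import numFieldNormedType.Exports.

Local Open Scope classical_set_scope.
Local Open Scope ring_scope.

Definition Gamma (R : realType) (z : R) : R :=
  \int[lebesgue_measure]_(t in `]0, +oo[) (t `^ (z - 1) * expR (- t)).

Definition jacobi_weight (R : realType) (alpha beta t : R) : R :=
  (1 - t) `^ alpha * (1 + t) `^ beta.

(* For alpha, beta > -1 these three conditions determine [P] uniquely. *)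
Definition is_jacobi (R : realType) (alpha beta : R) (P : nat -> {poly R}) :=
  [/\ forall j : nat, size (P j) = j.+1,
      forall i j : nat, i != j ->
        \int[lebesgue_measure]_(t in `[-1, 1])
          ((P i).[t] * (P j).[t] * jacobi_weight alpha beta t) = 0
    & forall j : nat, (P j).[1] =
        Gamma (j%:R + alpha + 1) / (Gamma (j%:R + 1) * Gamma (alpha + 1))].

(* Rows and columns are numbered from 0: [i : 'I_N] stands for the segment
   s_{i+1} = [x_i, x_{i+1}] and [j : 'I_N] for the basis element P_j. *)
Definition left_end (N : nat) (i : 'I_N) : 'I_N.+1 := widen_ord (leqnSn N) i.
Definition right_end (N : nat) (i : 'I_N) : 'I_N.+1 := lift ord0 i.

Definition seg_length (R : realType) (N : nat) (x : 'I_N.+1 -> R)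
    (i : 'I_N) : R :=
  x (right_end i) - x (left_end i).

(* In the next three definitions [P] is meant to be the Jacobi family with
   parameters alpha + 1, beta + 1, while the weight has parameters
   alpha, beta. *)
Definition histopolation_mx (R : realType) (alpha beta : R)
    (P : nat -> {poly R}) (N : nat) (x : 'I_N.+1 -> R) : 'M[R]_N :=
  \matrix_(i < N, j < N)
    ((seg_length x i)^-1 *
     \int[lebesgue_measure]_(t in `[x (left_end i), x (right_end i)])
       ((P j).[t] * jacobi_weight alpha beta t)).

Definition weighted_primitive (R : realType) (alpha beta : R)
    (P : nat -> {poly R}) (j : nat) (y : R) : R :=
  \int[lebesgue_measure]_(t in `[-1, y])
    ((P j).[t] * jacobi_weight alpha beta t).

Definition primitive_sampling_mx (R : realType) (alpha beta : R)
    (P : nat -> {poly R}) (N : nat) (x : 'I_N.+1 -> R) : 'M[R]_(N.+1, N) :=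
  \matrix_(k < N.+1, j < N) weighted_primitive alpha beta P j (x k).

Definition backward_diff (R : realType) (N : nat) (x : 'I_N.+1 -> R)
    (u : 'cV[R]_N.+1) : 'cV[R]_N :=
  \col_(i < N) ((u (right_end i) 0 - u (left_end i) 0) / seg_length x i).

(* The matrix of the linear map [backward_diff x] in the canonical bases. *)
Definition backward_diff_mx (R : realType) (N : nat) (x : 'I_N.+1 -> R) :
    'M[R]_(N, N.+1) :=
  \matrix_(i < N, k < N.+1) backward_diff x (delta_mx k 0) i 0.

(* Main.v *)
Require Import Defs.
From HB Require Import structures.
From mathcomp Require Import all_boot all_order all_algebra.
From mathcomp Require Import all_classical all_reals all_analysis.
From mathcomp Require Import measurable_realfun lra.

(** A histopolation coefficient is an average over a segment
    [[x_{i-1}, x_i]], and the integral over that segment is the increment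
    [psi_j(x_i) - psi_j(x_{i-1})] of the weighted primitive; dividing by [h_i]
    turns the increment into a backward difference of the samples of [psi_j].
    So the identity is additivity of the integral
    ([weighted_primitiveB]), read entry by entry through
    [backward_diff_mulmxE].

    Additivity needs the integrand to be integrable on [[-1, 1]]
    ([integrable_poly_jacobi_weight]).  For nonnegative exponents the Jacobi
    weight is measurable and bounded there, and a polynomial is continuous.  That all segments lie inside
    [[-1, 1]] comes from the monotonicity of the nodes ([homo_nodes]). *)

Import Order.TTheory GRing.Theory Num.Theory.

Local Open Scope ring_scope.

Lemma homo_nodes (d : Order.disp_t) (T : porderType d) (N : nat)
    (x : 'I_N.+1 -> T) :
  (forall i : 'I_N, x (left_end i) <= x (right_end i))%O ->
  {homo x : i j / (i <= j)%N >-> (i <= j)%O}.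
Proof.
move=> hx.
(* Freezing the nodes after the last one gives a sequence indexed by all of
   nat, to which induction applies. *)
have hstep n : (x (inord (minn n N)) <= x (inord (minn n.+1 N)))%O.
  have [leNn|ltnN] := leqP N n; first by rewrite (minn_idPr (leqW leNn)).
  rewrite (minn_idPl ltnN); have := hx (Ordinal ltnN).
  by congr (x _ <= x _)%O; apply/val_inj; rewrite /= inordK// ltnS ltnW.
have hE (i : 'I_N.+1) : inord (minn i N) = i.
  by rewrite (minn_idPl _) ?inord_val// -ltnS.
by move=> i j /(homo_leq lexx le_trans hstep); rewrite !hE.
Qed.

(** [backward_diff_mx] lists the values of [backward_diff] on the canonical
    basis, so by linearity its product with a matrix is [backward_diff] applied
    to each column. *)
Lemma backward_diff_mulmxE (R : realType) (N : nat) (x : 'I_N.+1 -> R)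
    (p : nat) (M : 'M[R]_(N.+1, p)) (i : 'I_N) (j : 'I_p) :
  (backward_diff_mx x *m M) i j = backward_diff x (col j M) i 0.
Proof.
have sum_pick (k0 : 'I_N.+1) :
    \sum_k (delta_mx k 0 : 'cV[R]_N.+1) k0 0 * M k j = M k0 j.
  rewrite (bigD1 k0)//= mxE !eqxx mul1r big1 ?addr0// => k kk0.
  by rewrite mxE eq_sym (negbTE kk0) mul0r.
rewrite !mxE -(sum_pick (right_end i)) -(sum_pick (left_end i)) -sumrB.
rewrite mulr_suml; apply: eq_bigr => k _.
by rewrite mxE /backward_diff mxE -mulrBl mulrAC.
Qed.

Section WeightedIntegrals.
Local Open Scope classical_set_scope.

(** Both [1 - t] and [1 + t] stay in [[0, 2]], where a power with nonnegative
    exponent is nondecreasing.  With a negative exponent the weight would be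
    unbounded near an endpoint. *)
Lemma jacobi_weight_bound (R : realType) (alpha beta t : R) :
  0 <= alpha -> 0 <= beta -> -1 <= t <= 1 ->
  `|jacobi_weight alpha beta t| <= 2 `^ alpha * 2 `^ beta.
Proof.
move=> ha hb /andP[ht1 ht2].
rewrite ger0_norm ?mulr_ge0 ?powR_ge0//.
by rewrite ler_pM ?powR_ge0// ge0_ler_powR ?nnegrE//; lra.
Qed.

Lemma measurable_jacobi_weight (R : realType) (alpha beta : R) (A : set R) :
  measurable_fun A (jacobi_weight alpha beta).
Proof.
apply/measurable_funTS/measurable_funM.
- apply: (measurableT_comp (measurable_powR alpha)).
  exact: measurable_funB.
- apply: (measurableT_comp (measurable_powR beta)).
  exact: measurable_funD.
Qed.

(** A bounded measurable factor times a function that is continuous on a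
    compact interval. *)
Lemma integrable_poly_jacobi_weight (R : realType) (alpha beta : R)
    (p : {poly R}) :
  0 <= alpha -> 0 <= beta ->
  lebesgue_measure.-integrable `[-1, 1 : R]
    (EFin \o (fun t => p.[t] * jacobi_weight alpha beta t)).
Proof.
move=> ha hb.
apply: (@integrableMl _ _ _ lebesgue_measure `[-1, 1 : R] _ (EFin \o horner p)
          (jacobi_weight alpha beta)) => //.
- apply: continuous_compact_integrable; first exact: segment_compact.
  exact/continuous_subspaceT/continuous_horner.
- exact: measurable_jacobi_weight.
- exists (2 `^ alpha * 2 `^ beta); split; first exact: num_real.
  move=> M /ltW leM t /=; rewrite in_itv/= => ht.
  by apply: le_trans leM; exact: jacobi_weight_bound.
Qed.

(** The bounds on [a] and [b] keep both integrals inside [[-1, 1]], where the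
    integrand is integrable and the real-valued integral is additive. *)
Lemma weighted_primitiveB (R : realType) (alpha beta : R)
    (P : nat -> {poly R}) (j : nat) (a b : R) :
  0 <= alpha -> 0 <= beta -> -1 <= a -> a <= b -> b <= 1 ->
  weighted_primitive alpha beta P j b - weighted_primitive alpha beta P j a =
  \int[lebesgue_measure]_(t in `[a, b]) ((P j).[t] * jacobi_weight alpha beta t).
Proof.
move=> ha hb h1a hab hb1; rewrite /weighted_primitive.
have hint := @integrable_poly_jacobi_weight R alpha beta (P j) ha hb.
(* The difference is an integral over the half-open `]a, b]; its missing
   endpoint has measure zero. *)
rewrite Rintegral_itvB ?bnd_simp//.
- rewrite Rintegral_itv_obnd_cbnd//; apply: integrableS hint => //.
  by apply: subset_itv; rewrite bnd_simp.
- by apply: integrableS hint => //; apply: subset_itv; rewrite bnd_simp.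
Qed.
End WeightedIntegrals.

Theorem theorem2p7 (R : realType) (alpha beta : R)
  (halpha : 0 < alpha) (hbeta : 0 < beta)
  (N : nat) (hN : (1 <= N)%N)
  (x : 'I_N.+1 -> R)
  (hx0 : x ord0 = -1) (hxN : x ord_max = 1)
  (hx : forall i : 'I_N, x (left_end i) < x (right_end i))
  (P : nat -> {poly R}) (hP : is_jacobi (alpha + 1) (beta + 1) P) :
  histopolation_mx alpha beta P x =
    backward_diff_mx x *m primitive_sampling_mx alpha beta P x.
Proof.
have x_homo : {homo x : i j / (i <= j)%N >-> i <= j}.
  by apply: homo_nodes => i; exact: ltW.
apply/matrixP => i j; rewrite backward_diff_mulmxE !mxE mulrC.
rewrite weighted_primitiveB//; do ?exact: ltW.
- by rewrite -hx0; exact: x_homo.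
- by rewrite -hxN; apply: x_homo; rewrite -ltnS ltn_ord.
Qed.
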